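(* Consider the family of linear initial value problems $U'(t)=F(t,U(t))$ ($0\le t\le T$), $U(0)=U_0$, in $\mathbb{R}^m$ with splitting $F=F_0+F_1+F_2$, $F_j(t,v)=A_jv+g_j(t)$, and the Modified Craig--Sneyd (MCS) scheme with parameter $\theta>0$ and $k=2$ applied to it, as described in the context. Let $\varphi_j(t)=F_j(t,U(t))$ for $0\le t\le T$ and $j=0,1,2$. Assume that: (i) the functions $\varphi_j$ ($j=0,1,2$) are twice continuously differentiable and their second derivatives are bounded on $[0,T]$ uniformly in the spatial mesh width; (ii) $(A_jv,v)\le 0$ whenever $v\in\mathbb{R}^m$ and $j=1,2$; (iii) the MCS scheme is stable, i.e. there exists a constant $M$ such that $\Vert R^n\Vert_2\le M$ uniformly in the spatial mesh width, $\Delta t>0$ and integer $n\ge 1$, where $$R = I + P^{-1}Z + P^{-1}\left(\theta Z_0+(\tfrac12-\theta)Z\right)P^{-1}Z;$$ (iv) the matrices $A$ and $P+\theta Z_0+(\tfrac12-\theta)Z$ are invertible; (v) the matrices $$A^{-1}A_1,\quad A^{-1}A_2,\quad I+P^{-1}\left(\theta Z_0+(\tfrac12-\theta)Z\right),\quad \left(P+\theta Z_0+(\tfrac12-\theta)Z\right)^{-1}$$ are all $\mathcal{O}(1)$. Then the global discretization errors $e_n=U(t_n)-U_n$ of the MCS scheme satisfy $e_n=\mathcal{O}\left((\Delta t)^2\right)$.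
   Context: Setting. One considers a family of semidiscrete systems (arising from spatial discretization of an initial-boundary value problem on the fixed time interval $[0,T]$), indexed by the (arbitrarily small) spatial mesh width. For each mesh width there are an integer $m\ge1$, real $m\times m$ matrices $A_0,A_1,A_2$, functions $g_0,g_1,g_2:[0,T]\to\mathbb{R}^m$ and an initial vector $U_0\in\mathbb{R}^m$, all of which may depend on the mesh width; $T$ and $\theta>0$ do not. Put $F_j(t,v)=A_jv+g_j(t)$, $A=A_0+A_1+A_2$, $g=g_0+g_1+g_2$, and $F(t,v)=F_0(t,v)+F_1(t,v)+F_2(t,v)=Av+g(t)$. $U:[0,T]\to\mathbb{R}^m$ denotes the exact solution of $U'(t)=F(t,U(t))$, $U(0)=U_0$. Norms. $(v,w)=\frac1m v^{\rm T}w$ for $v,w\in\mathbb{R}^m$, and $\Vert\cdot\Vert_2$ denotes the induced vector norm and the induced matrix norm. Matrices. For a time step $\Delta t>0$, let $I$ be the $m\times m$ identity and $Z=\Delta t A$, $Z_j=\Delta t A_j$ ($j=0,1,2$), $Q_j=I-\theta Z_j$ ($j=1,2$), $P=Q_1Q_2$. (Under assumption (ii) the matrices $Q_1,Q_2,P$ are invertible.) MCS scheme with $k=2$. With $t_n=n\Delta t$, starting from the given $U_0$, approximations $U_n$ to $U(t_n)$ are defined successively for $n=1,2,3,\ldots$ with $n\Delta t\le T$ by $$\begin{array}{l} Y_0=U_{n-1}+\Delta t\,F(t_{n-1},U_{n-1}),\\ Y_j=Y_{j-1}+\theta\Delta t\,(F_j(t_n,Y_j)-F_j(t_{n-1},U_{n-1})),\quad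 j=1,2,\\ \widehat Y_0=Y_0+\theta\Delta t\,(F_0(t_n,Y_2)-F_0(t_{n-1},U_{n-1})),\\ \widetilde Y_0=\widehat Y_0+(\tfrac12-\theta)\Delta t\,(F(t_n,Y_2)-F(t_{n-1},U_{n-1})),\\ \widetilde Y_j=\widetilde Y_{j-1}+\theta\Delta t\,(F_j(t_n,\widetilde Y_j)-F_j(t_{n-1},U_{n-1})),\quad j=1,2,\\ U_n=\widetilde Y_2. \end{array}$$ $\mathcal{O}$-notation. A vector or matrix is $\mathcal{O}\left((\Delta t)^p\right)$ if its norm $\Vert\cdot\Vert_2$ is bounded by a positive constant times $(\Delta t)^p$, where the constant is independent of the spatial mesh width, the time step size $\Delta t>0$ and the step number $n\ge1$ with $n\Delta t\le T$; $\mathcal{O}(1)$ is the case $p=0$. Boundedness of functions on $[0,T]$ is likewise with respect to $\Vert\cdot\Vert_2$.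
   Formalization: Assumption (i) is strengthened: the first derivatives of φ_0, φ_1, φ_2 are also assumed bounded on [0,T] uniformly in the spatial mesh width; with only the second derivatives bounded the claim fails (e.g. φ_2(t)=t/h with mesh width h). *)

(* Defs.v *)
From HB Require Import structures.
From mathcomp Require Import all_boot all_order all_algebra.
From mathcomp Require Import all_classical all_reals all_analysis.

Set Implicit Arguments.
Unset Strict Implicit.
Unset Printing Implicit Defensive.

Import Order.TTheory GRing.Theory Num.Theory.
Import numFieldNormedType.Exports.

Local Open Scope classical_set_scope.
Local Open Scope ring_scope.

Section Norms.
Variables (R : realType) (m : nat).

Definition dotm (v w : 'cV[R]_m) : R := m%:R^-1 * (v^T *m w) 0 0.

Definition vnorm2 (v : 'cV[R]_m) : R := Num.sqrt (dotm v v).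

Definition mnorm2 (B : 'M[R]_m) : R :=
  sup [set vnorm2 (B *m v) / vnorm2 v | v in [set v : 'cV[R]_m | v != 0]].

End Norms.

(* [f'] is the derivative of [f] on the closed interval [0, T], one-sided at
   the two endpoints; values outside [0, T] are irrelevant. *)
Definition derivative_on (R : realType) (m : nat) (T : R)
    (f f' : R -> 'cV[R]_m) : Prop :=
  forall t : R, t \in `[0, T] ->
    (s - t)^-1 *: (f s - f t) @[s --> within `[0, T]%classic t^'] --> f' t.

(* One member of the family: U' = F(t, U), U(0) = Uinit in R^sdim, with
   F = F_0 + F_1 + F_2 and F_j(t, v) = A_j v + g_j(t), for j in {0, 1, 2};
   only the values of g_j on [0, T] matter. *)
Record system (R : realType) := System {
  sdim : nat;
  sdim_gt0 : (0 < sdim)%N;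
  Aj : 'I_3 -> 'M[R]_sdim;
  gj : 'I_3 -> R -> 'cV[R]_sdim;
  Uinit : 'cV[R]_sdim
}.

Section Scheme.
Variables (R : realType) (S : system R).

Definition Fj (j : 'I_3) (t : R) (v : 'cV[R]_(sdim S)) : 'cV[R]_(sdim S) :=
  Aj S j *m v + gj S j t.

Definition Atot : 'M[R]_(sdim S) := Aj S 0 + Aj S 1 + Aj S 2.

Definition Ftot (t : R) (v : 'cV[R]_(sdim S)) : 'cV[R]_(sdim S) :=
  Fj 0 t v + Fj 1 t v + Fj 2 t v.

Definition exact_solution (T : R) (U : R -> 'cV[R]_(sdim S)) : Prop :=
  derivative_on T U (fun t => Ftot t (U t)) /\ U 0 = Uinit S.

Variables theta dt : R.

Definition Ztot : 'M[R]_(sdim S) := dt *: Atot.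
Definition Zj (j : 'I_3) : 'M[R]_(sdim S) := dt *: Aj S j.
Definition Qj (j : 'I_3) : 'M[R]_(sdim S) := 1%:M - theta *: Zj j.
Definition Pmat : 'M[R]_(sdim S) := Qj 1 *m Qj 2.

Definition Nmat : 'M[R]_(sdim S) := theta *: Zj 0 + (2^-1 - theta) *: Ztot.

Definition Rmat : 'M[R]_(sdim S) :=
  1%:M + invmx Pmat *m Ztot + invmx Pmat *m Nmat *m invmx Pmat *m Ztot.

(* The stages are implicit, so one step from time [s] to time [t] = [s] + [dt]
   is a relation between the approximations [u] at [s] and [u'] at [t]. *)
Definition MCS_step (s t : R) (u u' : 'cV[R]_(sdim S)) : Prop :=
  exists Y0 Y1 Y2 Yh0 Yt0 Yt1 Yt2 : 'cV[R]_(sdim S),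
  [/\ Y0 = u + dt *: Ftot s u,
      Y1 = Y0 + (theta * dt) *: (Fj 1 t Y1 - Fj 1 s u) /\
      Y2 = Y1 + (theta * dt) *: (Fj 2 t Y2 - Fj 2 s u),
      Yh0 = Y0 + (theta * dt) *: (Fj 0 t Y2 - Fj 0 s u) /\
      Yt0 = Yh0 + ((2^-1 - theta) * dt) *: (Ftot t Y2 - Ftot s u),
      Yt1 = Yt0 + (theta * dt) *: (Fj 1 t Yt1 - Fj 1 s u) /\
      Yt2 = Yt1 + (theta * dt) *: (Fj 2 t Yt2 - Fj 2 s u)
    & u' = Yt2].

Definition MCS_approx (T : R) (V : nat -> 'cV[R]_(sdim S)) : Prop :=
  V 0%N = Uinit S /\
  forall n : nat, n.+1%:R * dt <= T ->
    MCS_step (n%:R * dt) (n.+1%:R * dt) (V n) (V n.+1).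

End Scheme.

Definition mesh_widths (R : realType) (H : set R) : Prop :=
  (forall h, H h -> 0 < h) /\
  (forall eps : R, 0 < eps -> exists2 h, H h & h < eps).

(* [X h dt n] is the norm of the quantity being estimated. *)
Definition isO (R : realType) (H : set R) (T : R) (p : nat)
    (X : R -> R -> nat -> R) : Prop :=
  exists2 C : R, 0 < C &
    forall h : R, H h -> forall dt : R, 0 < dt ->
    forall n : nat, (1 <= n)%N -> n%:R * dt <= T ->
      X h dt n <= C * dt ^+ p.

Definition uniformly_bounded_on (R : realType) (H : set R) (T : R)
    (S : R -> system R) (f : forall h : R, R -> 'cV[R]_(sdim (S h))) : Prop :=
  exists K : R, forall h : R, H h -> forall t : R, t \in `[0, T] ->
    vnorm2 (f h t) <= K.

(* Main.v *)
Require Import Defs.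
From mathcomp Require Import all_boot all_order all_algebra.
From mathcomp Require Import all_classical all_reals all_analysis.
From mathcomp Require Import ring lra.

Set Implicit Arguments.
Unset Strict Implicit.
Unset Printing Implicit Defensive.

Import Order.TTheory GRing.Theory Num.Theory.
Import numFieldNormedType.Exports.

Local Open Scope classical_set_scope.
Local Open Scope ring_scope.

(** Why second order holds, although one step has an error of only second order
in dt uniformly in the mesh width.

Write e_n for the global error, tau_n for the residual of the exact solution
in the trapezoidal rule on the n-th step, and delta_j for the increments of
phi_j over that step.  Subtracting the scheme from the exact solution stage by
stage gives e_n = R e_(n-1) + d_n.  The residual tau_n enters d_n as
P^-1 tau_n; since P^-1 = (I + P^-1 N) (P + N)^-1, where
N = theta Z_0 + (1/2 - theta) Z, the matrix P^-1 is O(1) and this part is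
O(dt^3).  The splitting contributes further terms that are only O(dt^2), and
summing T/dt of them would lose an order.  But they have the form
(R - I) xi_n, where

  xi_n = (A^-1 (A/2 - theta A_1 - theta A_2)) (P + N)^-1 sigma_n
         + theta^2 dt A^-1 A_1 delta_2,
  sigma_n = tau_n + dt ((delta_0 + delta_1 + delta_2) / 2
                        - theta delta_1 - theta delta_2).

The coefficients in xi_n are bounded by the hypotheses on A^-1 A_1, A^-1 A_2
and (P + N)^-1 ([corrector], [MCS_step_error]).  So xi_n = O(dt^2), and
xi_n - xi_(n-1) = O(dt^3) because only first differences of the delta_j
occur ([corrector_bound]).  Summation by parts then finishes the proof:
e_n + xi_n = R (e_(n-1) + xi_(n-1)) + R (xi_n - xi_(n-1)) + O(dt^3), so power
boundedness of R bounds e_n + xi_n by M (O(dt^2) + n O(dt^3)) = O(dt^2)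
([error_accumulation]).

The required bounds on increments, second differences and tau_n are mean value
estimates for vector functions, obtained by testing against a fixed vector. *)

(** * The scaled Euclidean norm and its matrix norm *)

Lemma dotmE (R : realType) (m : nat) (v w : 'cV[R]_m) :
  dotm v w = m%:R^-1 * \sum_i v i 0 * w i 0.
Proof. by rewrite /dotm mxE; under eq_bigr do rewrite mxE. Qed.

Lemma dotmC (R : realType) (m : nat) (v w : 'cV[R]_m) : dotm v w = dotm w v.
Proof. by rewrite !dotmE; under eq_bigr do rewrite mulrC. Qed.

Lemma dotmDr (R : realType) (m : nat) (u v w : 'cV[R]_m) :
  dotm u (v + w) = dotm u v + dotm u w.
Proof. by rewrite /dotm mulmxDr mxE mulrDr. Qed.

Lemma dotmZr (R : realType) (m : nat) (a : R) (u v : 'cV[R]_m) :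
  dotm u (a *: v) = a * dotm u v.
Proof. by rewrite /dotm -scalemxAr mxE mulrCA. Qed.

Lemma dotmNr (R : realType) (m : nat) (u v : 'cV[R]_m) :
  dotm u (- v) = - dotm u v.
Proof. by rewrite -scaleN1r dotmZr mulN1r. Qed.

Lemma dotmDl (R : realType) (m : nat) (u v w : 'cV[R]_m) :
  dotm (v + w) u = dotm v u + dotm w u.
Proof. by rewrite ![dotm _ u]dotmC dotmDr. Qed.

Lemma dotmZl (R : realType) (m : nat) (a : R) (u v : 'cV[R]_m) :
  dotm (a *: v) u = a * dotm v u.
Proof. by rewrite ![dotm _ u]dotmC dotmZr. Qed.

Lemma dotmNl (R : realType) (m : nat) (u v : 'cV[R]_m) :
  dotm (- v) u = - dotm v u.
Proof. by rewrite ![dotm _ u]dotmC dotmNr. Qed.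

Lemma dotm_ge0 (R : realType) (m : nat) (v : 'cV[R]_m) : 0 <= dotm v v.
Proof.
rewrite dotmE mulr_ge0 ?invr_ge0 ?ler0n //.
by apply: sumr_ge0 => i _; rewrite -expr2 sqr_ge0.
Qed.

Lemma dotm_eq0 (R : realType) (m : nat) (v : 'cV[R]_m) :
  (dotm v v == 0) = (v == 0).
Proof.
apply/idP/eqP => [|->]; last by rewrite /dotm mulmx0 mxE mulr0.
case: m v => [|m] v; first by move=> _; apply/matrixP => -[].
rewrite dotmE mulf_eq0 invr_eq0 pnatr_eq0 /=.
rewrite psumr_eq0 => [/allP v0|i _]; last by rewrite -expr2 sqr_ge0.
apply/colP => i; rewrite mxE; apply/eqP.
by have := v0 i (mem_index_enum i); rewrite mulf_eq0 orbb.
Qed.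

Lemma vnorm2_ge0 (R : realType) (m : nat) (v : 'cV[R]_m) : 0 <= vnorm2 v.
Proof. exact: sqrtr_ge0. Qed.

Lemma vnorm2_sqr (R : realType) (m : nat) (v : 'cV[R]_m) :
  vnorm2 v ^+ 2 = dotm v v.
Proof. by rewrite sqr_sqrtr ?dotm_ge0. Qed.

Lemma vnorm2_eq0 (R : realType) (m : nat) (v : 'cV[R]_m) :
  (vnorm2 v == 0) = (v == 0).
Proof. by rewrite -dotm_eq0 -vnorm2_sqr sqrf_eq0. Qed.

Lemma vnorm2_0 (R : realType) (m : nat) : vnorm2 (0 : 'cV[R]_m) = 0.
Proof. by apply/eqP; rewrite vnorm2_eq0. Qed.

Lemma vnorm2Z (R : realType) (m : nat) (a : R) (v : 'cV[R]_m) :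
  vnorm2 (a *: v) = `|a| * vnorm2 v.
Proof.
by rewrite /vnorm2 dotmZl dotmZr mulrA -expr2 sqrtrM ?sqr_ge0 // sqrtr_sqr.
Qed.

Lemma vnorm2N (R : realType) (m : nat) (v : 'cV[R]_m) : vnorm2 (- v) = vnorm2 v.
Proof. by rewrite -scaleN1r vnorm2Z normrN1 mul1r. Qed.

(** Cauchy-Schwarz: expand the square of |w|^2 v - (v, w) w. *)
Lemma dotm_le_vnorm2 (R : realType) (m : nat) (v w : 'cV[R]_m) :
  dotm v w <= vnorm2 v * vnorm2 w.
Proof.
have [->|w0] := eqVneq w 0.
  by rewrite vnorm2_0 mulr0 /dotm mulmx0 mxE mulr0.
have W : 0 < vnorm2 w by rewrite lt0r vnorm2_eq0 w0 vnorm2_ge0.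
have V := vnorm2_ge0 v.
apply: le_trans (ler_norm _) _.
rewrite -ler_sqr ?nnegrE ?mulr_ge0 ?(ltW W) // real_normK ?num_real //.
have := dotm_ge0 (vnorm2 w ^+ 2 *: v - dotm v w *: w).
rewrite !(dotmDl, dotmDr, dotmNl, dotmNr, dotmZl, dotmZr) -!vnorm2_sqr.
rewrite (dotmC w v) => h.
rewrite -subr_ge0 -(pmulr_rge0 _ (exprn_gt0 2 W)).
by apply: le_trans h _; rewrite le_eqVlt; apply/orP; left; apply/eqP; ring.
Qed.

Lemma ler_vnorm2D (R : realType) (m : nat) (v w : 'cV[R]_m) :
  vnorm2 (v + w) <= vnorm2 v + vnorm2 w.
Proof.
have V := vnorm2_ge0 v; have W := vnorm2_ge0 w.
rewrite -ler_sqr ?nnegrE ?addr_ge0 ?vnorm2_ge0 // vnorm2_sqr.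
rewrite dotmDl !dotmDr -!vnorm2_sqr (dotmC w v).
have := dotm_le_vnorm2 v w; lra.
Qed.

Lemma ler_vnorm2B (R : realType) (m : nat) (v w : 'cV[R]_m) :
  vnorm2 (v - w) <= vnorm2 v + vnorm2 w.
Proof. by rewrite -(vnorm2N w); exact: ler_vnorm2D. Qed.

Lemma ler_vnorm2_sum (R : realType) (m : nat) (I : finType)
    (F : I -> 'cV[R]_m) :
  vnorm2 (\sum_i F i) <= \sum_i vnorm2 (F i).
Proof.
elim/big_rec2: _ => [|i a v _ h]; first by rewrite vnorm2_0.
by apply: le_trans (ler_vnorm2D _ _) _; rewrite lerD2l.
Qed.

(** Reduces an estimate of a vector function to scalar functions, for which a
mean value theorem is available. *)
Lemma vnorm2_dual (R : realType) (m : nat) (v : 'cV[R]_m) (K : R) :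
  0 <= K -> (forall u, dotm u v <= K * vnorm2 u) -> vnorm2 v <= K.
Proof.
move=> K0 h; have [->|v0] := eqVneq v 0; first by rewrite vnorm2_0.
have W : 0 < vnorm2 v by rewrite lt0r vnorm2_eq0 v0 vnorm2_ge0.
by have := h v; rewrite -vnorm2_sqr expr2 ler_pM2r.
Qed.

Lemma norm_coord_le (R : realType) (m : nat) (v : 'cV[R]_m) (i : 'I_m) :
  `|v i 0| <= Num.sqrt m%:R * vnorm2 v.
Proof.
have m0 : m%:R != 0 :> R.
  by rewrite pnatr_eq0 -lt0n (leq_ltn_trans _ (ltn_ord i)).
rewrite -sqrtrM ?ler0n // dotmE mulrA divff // mul1r -sqrtr_sqr.
rewrite ler_wsqrtr // (bigD1 i) //= expr2 lerDl.
by apply: sumr_ge0 => j _; rewrite -expr2 sqr_ge0.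
Qed.

(** The supremum that defines the matrix norm is only meaningful once the set of
quotients is known to be bounded; the columns of B give a crude bound. *)
Lemma ler_mnorm2 (R : realType) (m : nat) (B : 'M[R]_m) (v : 'cV[R]_m) :
  vnorm2 (B *m v) <= mnorm2 B * vnorm2 v.
Proof.
have [->|v0] := eqVneq v 0; first by rewrite mulmx0 vnorm2_0 mulr0.
have W w : w != 0 -> 0 < vnorm2 (w : 'cV[R]_m).
  by move=> w0; rewrite lt0r vnorm2_eq0 w0 vnorm2_ge0.
rewrite -ler_pdivrMr ?W //; apply: ub_le_sup; last by exists v.
exists (Num.sqrt m%:R * \sum_j vnorm2 (col j B)) => _ [w /= w0 <-].
rewrite ler_pdivrMr ?W //.
have -> : B *m w = \sum_j w j 0 *: col j B.
  apply/colP => i; rewrite mxE summxE.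
  by apply: eq_bigr => j _; rewrite !mxE mulrC.
apply: le_trans (ler_vnorm2_sum _) _.
rewrite mulrAC mulr_sumr; apply: ler_sum => j _.
by rewrite vnorm2Z ler_wpM2r ?vnorm2_ge0 ?norm_coord_le.
Qed.

Lemma vnorm2_mulmx_le (R : realType) (m : nat) (B : 'M[R]_m) (v : 'cV[R]_m)
    (b x : R) :
  mnorm2 B <= b -> 0 <= b -> vnorm2 v <= x -> vnorm2 (B *m v) <= b * x.
Proof.
move=> Bb b0 vx; apply: le_trans (ler_mnorm2 _ _) _.
apply: le_trans (_ : b * vnorm2 v <= _); last exact: ler_wpM2l.
by rewrite ler_wpM2r ?vnorm2_ge0.
Qed.

(** * Mean value estimates *)

(** What the mean value theorem asks of a function on a compact interval:
differentiability inside, but only continuity at the two ends. *)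
Definition scalar_derivative_on (R : realType) (T : R) (f f' : R -> R) : Prop :=
  {within `[0, T], continuous f} /\
  forall t : R, t \in `]0, T[ -> is_derive t 1 f (f' t).

(** First-order approximation on the closed interval handles the endpoints
and the interior uniformly; inside, it is differentiability because nearby
points do not leave the interval. *)
Lemma linear_approx_derivative_on (R : realType) (T : R) (f f' : R -> R) :
  (forall t : R, t \in `[0, T] -> forall e : R, 0 < e ->
     \forall s \near t, s \in `[0, T] ->
       `|f s - f t - (s - t) * f' t| <= e * `|s - t|) ->
  scalar_derivative_on T f f'.
Proof.
move=> ff'; split.
  apply/subspace_continuousP => t tT; apply/cvgrPdist_le => e e0.
  have K0 : 0 < 1 + `|f' t| by rewrite ltr_pwDl.
  have := ff' t tT 1 ltr01.
  have : \forall s \near t, `|t - s| <= e / (1 + `|f' t|).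
    apply/nbhs_ballP; exists (e / (1 + `|f' t|)); first exact: divr_gt0.
    by move=> s /ltW.
  apply: filterS2 => s ste h sT.
  have {h} := h sT; rewrite mul1r => h.
  rewrite distrC -(subrK ((s - t) * f' t) (f s - f t)).
  apply: le_trans (ler_normD _ _) _.
  apply: le_trans (lerD h (lexx _)) _.
  move: ste; rewrite ler_pdivlMr // distrC => ste.
  by apply: le_trans ste; rewrite normrM mulrDr mulr1.
move=> t tT.
have tT' : t \in `[0, T] by apply: subset_itv_oo_cc tT.
have quot : (h^-1 *: ((f \o shift t) (h *: 1) - f t)) @[h --> 0^'] --> f' t.
  apply/cvgrPdist_le => e e0.
  have /nbhs_ballP[d d0 hd] : \forall s \near t,
      `|f s - f t - (s - t) * f' t| <= e * `|s - t|.
    apply: filterS2 (near_in_itvoo tT) (ff' t tT' e e0) => s sT; apply.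
    exact: subset_itv_oo_cc sT.
  have : \forall h \near (0 : R)^', ball t d (h + t).
    apply: nbhs_dnbhs; apply/nbhs_ballP; exists d => // h.
    by rewrite /ball /= sub0r opprD [t + _]addrC subrK.
  apply: filterS2 (nbhs_dnbhs_neq 0) => h h0 /hd /=.
  rewrite addrK [h *: 1]mulr1 => fh.
  rewrite -(ler_pM2l (_ : 0 < `|h|)) ?normr_gt0 // [X in _ <= X]mulrC.
  apply: le_trans fh; rewrite -normrM mulrBr.
  by rewrite -[X in _ - X]/(h * (h^-1 * _)) mulrA mulfV // mul1r distrC.
by split; [apply/cvg_ex; exists (f' t)|exact/cvg_lim].
Qed.

Lemma derivative_on_scalar (R : realType) (m : nat) (T : R)
    (f f' : R -> 'cV[R]_m) (u : 'cV[R]_m) :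
  derivative_on T f f' ->
  scalar_derivative_on T (fun t => dotm u (f t)) (fun t => dotm u (f' t)).
Proof.
move=> ff'; apply: linear_approx_derivative_on => t tT e e0.
have : dotm u ((s - t)^-1 *: (f s - f t)) @[s --> within `[0, T]%classic t^']
    --> dotm u (f' t).
  rewrite dotmE; under eq_fun do rewrite dotmE.
  apply: cvgMl_tmp; apply: cvg_big => [|i _]; first exact: add_continuous.
  apply: cvgMl_tmp.
  exact: (continuous_cvg _ (@coord_continuous R m 1 i 0 _) (ff' t tT)).
move=> /cvgrPdist_le /(_ e e0) h.
apply: (@filterS _ (nbhs t) _ _ _ _ h) => {h} s /= h sT.
have [->|st] := eqVneq s t; first by rewrite !subrr mul0r subr0 normr0 mulr0.
have st0 : s - t != 0 by rewrite subr_eq0.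
have {h} := h st sT; rewrite dotmZr dotmDr dotmNr distrC => h.
rewrite -ler_pdivrMr ?normr_gt0 // -normfV -normrM mulrBl mulrC.
by rewrite [X in _ - X]mulrAC mulrV ?unitfE // mul1r.
Qed.
Lemma MVT_on (R : realType) (T : R) (f f' : R -> R) (s t : R) :
  scalar_derivative_on T f f' -> 0 <= s -> s <= t -> t <= T ->
  exists2 c : R, c \in `[s, t] & f t - f s = f' c * (t - s).
Proof.
move=> [fc fd] s0 st tT.
have fd' x : x \in `]s, t[ -> is_derive x 1 f (f' x).
  rewrite in_itv /= => /andP[sx xt]; apply: fd.
  by rewrite in_itv /= (le_lt_trans s0 sx) (lt_le_trans xt tT).
have fc' : {within `[s, t], continuous f}.
  apply: continuous_subspaceW fc => x /=; rewrite !in_itv /= => /andP[sx xt].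
  by rewrite (le_trans s0 sx) (le_trans xt tT).
by have [c cst fE] := MVT_segment st fd' fc'; exists c.
Qed.

Lemma scalar_lipschitz (R : realType) (T K : R) (f f' : R -> R) (s t : R) :
  scalar_derivative_on T f f' ->
  (forall x, x \in `[0, T] -> `|f' x| <= K) ->
  s \in `[0, T] -> t \in `[0, T] -> `|f t - f s| <= K * `|t - s|.
Proof.
move=> fd fK.
wlog st : s t / s <= t => [h sT tT|].
  have [/h|/ltW /h] := leP s t; first exact.
  by rewrite distrC [`|t - s|]distrC; exact.
rewrite !in_itv /= => /andP[s0 sT] /andP[t0 tT].
have [c] := MVT_on fd s0 st tT; rewrite in_itv /= => /andP[sc ct] ->.
by rewrite normrM ler_wpM2r // fK // in_itv /=; lra.
Qed.

(** Stated for s and t in either order, so that an expansion about a point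
applies on both sides of it. *)
Lemma scalar_taylor1 (R : realType) (T K : R) (f f' f'' : R -> R) (s t : R) :
  scalar_derivative_on T f f' -> scalar_derivative_on T f' f'' ->
  (forall x, x \in `[0, T] -> `|f'' x| <= K) ->
  s \in `[0, T] -> t \in `[0, T] ->
  `|f t - f s - f' s * (t - s)| <= K * (t - s) ^+ 2.
Proof.
move=> fd fd' fK sT0 tT0; move: (sT0) (tT0).
have K0 : 0 <= K by apply: le_trans (fK s sT0).
rewrite !in_itv /= => /andP[s0 sT] /andP[t0 tT].
suff [c [cT cst ->]] : exists c, [/\ c \in `[0, T], `|c - s| <= `|t - s| &
    f t - f s = f' c * (t - s)].
  rewrite -mulrBl normrM -[(t - s) ^+ 2]real_normK ?num_real // expr2 mulrA.
  rewrite ler_wpM2r //; apply: le_trans (scalar_lipschitz fd' fK sT0 cT) _.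
  exact: ler_wpM2l.
have [st|/ltW ts] := leP s t.
- have [c] := MVT_on fd s0 st tT; rewrite in_itv /= => /andP[sc ct] fE.
  exists c; split => //; first by rewrite in_itv /=; lra.
  by rewrite !ger0_norm ?subr_ge0 ?lerD2r.
- have [c] := MVT_on fd t0 ts sT; rewrite in_itv /= => /andP[sc ct] fE.
  exists c; split; first by rewrite in_itv /=; lra.
    by rewrite !ler0_norm ?subr_le0 ?lerN2 ?lerD2r.
  by rewrite -[LHS]opprB fE -mulrN opprB.
Qed.

(** Both outer values are expanded about the midpoint s + d, where the first
order terms cancel; this costs a factor 2 in the constant. *)
Lemma scalar_second_difference (R : realType) (T K : R) (f f' f'' : R -> R)
    (s d : R) :
  scalar_derivative_on T f f' -> scalar_derivative_on T f' f'' ->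
  (forall x, x \in `[0, T] -> `|f'' x| <= K) ->
  0 <= s -> 0 <= d -> s + d + d <= T ->
  `|(f (s + d + d) - f (s + d)) - (f (s + d) - f s)| <= 2 * K * d ^+ 2.
Proof.
move=> fd fd' fK s0 d0 sdT.
have sT : s \in `[0, T] by rewrite in_itv /=; lra.
have mT : s + d \in `[0, T] by rewrite in_itv /=; lra.
have eT : s + d + d \in `[0, T] by rewrite in_itv /=; lra.
have := scalar_taylor1 fd fd' fK mT sT.
have := scalar_taylor1 fd fd' fK mT eT.
have -> : s + d + d - (s + d) = d by ring.
have -> : s - (s + d) = - d by ring.
rewrite sqrrN !ler_norml => /andP[a1 a2] /andP[b1 b2].
by apply/andP; split; lra.
Qed.

(** The trapezoidal residual on [s, x], as a function G of the endpoint x, has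
derivative - (f s - f x - f' x (s - x)) / 2, which is a first-order Taylor
remainder and so at most K (x - s)^2 / 2; the mean value theorem for G adds the
third power of d. *)
Lemma scalar_trapezoidal (R : realType) (T K : R) (u f f' f'' : R -> R)
    (s d : R) :
  scalar_derivative_on T u f ->
  scalar_derivative_on T f f' -> scalar_derivative_on T f' f'' ->
  (forall x, x \in `[0, T] -> `|f'' x| <= K) ->
  0 <= s -> 0 <= d -> s + d <= T ->
  `|u (s + d) - u s - d / 2 * (f (s + d) + f s)| <= K / 2 * d ^+ 3.
Proof.
move=> ud fd fd' fK s0 d0 sdT.
pose G := u - (fun x => (x - s) / 2) * (f + cst (f s)).
have sT : s \in `[0, T] by rewrite in_itv /=; lra.
have K0 : 0 <= K by apply: le_trans (fK s sT).
have Gd : scalar_derivative_on T G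
    (fun x => f x - (2^-1 * (f x + f s) + (x - s) / 2 * f' x)).
  split.
    move=> x; apply: cvgB; first exact: ud.1.
    apply: cvgM; last by apply: cvgD; [exact: fd.1|exact: cvg_cst].
    apply: cvgMr_tmp; apply: cvgB; last exact: cvg_cst.
    exact: (@incl_subspace_continuous _ `[0, T]%classic x).
  move=> x xT; have ? := ud.2 x xT; have ? := fd.2 x xT.
  apply: is_derive_eq.
  rewrite /cst /GRing.scale /=.
  by rewrite fctE; clear; field.
have st : s <= s + d by lra.
have [c] := MVT_on Gd s0 st sdT; rewrite /G !fctE /= in_itv /= => /andP[sc cd].
have -> : s + d - s = d by ring.
rewrite subrr !mul0r subr0 => E.
have cT : c \in `[0, T] by rewrite in_itv /=; clear -s0 sdT sc cd; lra.
have Tc := scalar_taylor1 fd fd' fK cT sT.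
rewrite [X in `|X|](_ : _ = - (d / 2) * (f s - f c - f' c * (s - c))).
  rewrite normrM normrN (@ger0_norm _ (d / 2)) ?divr_ge0 //.
  have -> : K / 2 * d ^+ 3 = d / 2 * (K * d ^+ 2) by field.
  rewrite ler_wpM2l ?divr_ge0 //.
  apply: le_trans Tc _; rewrite ler_wpM2l //.
  by rewrite -sqrrN opprB ler_sqr ?nnegrE; clear -s0 sc cd; lra.
by move: E => /(canRL (subrK _)) E; clear -E; lra.
Qed.
Lemma norm_dotm_le (R : realType) (m : nat) (u v : 'cV[R]_m) :
  `|dotm u v| <= vnorm2 v * vnorm2 u.
Proof.
rewrite ler_norml [_ * vnorm2 u]mulrC dotm_le_vnorm2 andbT lerNl -dotmNr.
by rewrite -(vnorm2N v) dotm_le_vnorm2.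
Qed.

Lemma lipschitz_bound (R : realType) (m : nat) (T K : R)
    (f f' : R -> 'cV[R]_m) (s t : R) :
  derivative_on T f f' ->
  (forall x, x \in `[0, T] -> vnorm2 (f' x) <= K) ->
  s \in `[0, T] -> t \in `[0, T] -> vnorm2 (f t - f s) <= K * `|t - s|.
Proof.
move=> fd fK sT tT.
have K0 : 0 <= K by apply: le_trans (fK s sT); exact: vnorm2_ge0.
apply: vnorm2_dual => [|u]; first by rewrite mulr_ge0.
have uK x : x \in `[0, T] -> `|dotm u (f' x)| <= K * vnorm2 u.
  move=> xT; apply: le_trans (norm_dotm_le _ _) _.
  by rewrite ler_wpM2r ?vnorm2_ge0 ?fK.
have := scalar_lipschitz (derivative_on_scalar u fd) uK sT tT.
rewrite -dotmNr -dotmDr mulrAC; exact/le_trans/ler_norm.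
Qed.

Lemma second_difference_bound (R : realType) (m : nat) (T K : R)
    (f f' f'' : R -> 'cV[R]_m) (s d : R) :
  derivative_on T f f' -> derivative_on T f' f'' ->
  (forall x, x \in `[0, T] -> vnorm2 (f'' x) <= K) ->
  0 <= s -> 0 <= d -> s + d + d <= T ->
  vnorm2 ((f (s + d + d) - f (s + d)) - (f (s + d) - f s)) <= 2 * K * d ^+ 2.
Proof.
move=> fd fd' fK s0 d0 sdT.
have sT : s \in `[0, T] by rewrite in_itv /=; clear -s0 d0 sdT; lra.
have K0 : 0 <= K by apply: le_trans (fK s sT); exact: vnorm2_ge0.
apply: vnorm2_dual => [|u]; first by rewrite !mulr_ge0.
have uK x : x \in `[0, T] -> `|dotm u (f'' x)| <= K * vnorm2 u.
  move=> xT; apply: le_trans (norm_dotm_le _ _) _.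
  by rewrite ler_wpM2r ?vnorm2_ge0 ?fK.
have := scalar_second_difference (derivative_on_scalar u fd)
  (derivative_on_scalar u fd') uK s0 d0 sdT.
rewrite -!(dotmNr, dotmDr) -mulrA [_ * _ * d ^+ 2]mulrAC mulrA mulrA.
exact/le_trans/ler_norm.
Qed.

Lemma trapezoidal_bound (R : realType) (m : nat) (T K : R)
    (v f f' f'' : R -> 'cV[R]_m) (s d : R) :
  derivative_on T v f -> derivative_on T f f' -> derivative_on T f' f'' ->
  (forall x, x \in `[0, T] -> vnorm2 (f'' x) <= K) ->
  0 <= s -> 0 <= d -> s + d <= T ->
  vnorm2 (v (s + d) - v s - (d / 2) *: (f (s + d) + f s)) <= K / 2 * d ^+ 3.
Proof.
move=> vd fd fd' fK s0 d0 sdT.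
have sT : s \in `[0, T] by rewrite in_itv /=; clear -s0 d0 sdT; lra.
have K0 : 0 <= K by apply: le_trans (fK s sT); exact: vnorm2_ge0.
apply: vnorm2_dual => [|u]; first by rewrite !mulr_ge0 ?exprn_ge0.
have uK x : x \in `[0, T] -> `|dotm u (f'' x)| <= K * vnorm2 u.
  move=> xT; apply: le_trans (norm_dotm_le _ _) _.
  by rewrite ler_wpM2r ?vnorm2_ge0 ?fK.
have := scalar_trapezoidal (derivative_on_scalar u vd)
  (derivative_on_scalar u fd) (derivative_on_scalar u fd') uK s0 d0 sdT.
rewrite -!(dotmNr, dotmDr, dotmZr).
have -> : K * vnorm2 u / 2 * d ^+ 3 = K / 2 * d ^+ 3 * vnorm2 u by field.
exact/le_trans/ler_norm.
Qed.

Lemma derivative_onD (R : realType) (m : nat) (T : R)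
    (f f' g g' : R -> 'cV[R]_m) :
  derivative_on T f f' -> derivative_on T g g' ->
  derivative_on T (fun t => f t + g t) (fun t => f' t + g' t).
Proof.
move=> fd gd t tT.
under eq_fun do rewrite opprD addrACA scalerDr.
exact: cvgD (fd t tT) (gd t tT).
Qed.

(** * The error of one step *)

(** If v = a B v then (v, v) = a (B v, v) <= 0, so v = 0. *)
Lemma dissipative_shift_unit (R : realType) (m : nat) (B : 'M[R]_m) (a : R) :
  0 <= a -> (forall v, dotm (B *m v) v <= 0) -> 1%:M - a *: B \in unitmx.
Proof.
move=> a0 dB; rewrite -unitmx_tr -row_free_unit -kermx_eq0.
apply/eqP/row_matrixP => i; rewrite row0.
set r := row i _.
have r0 : r *m (1%:M - a *: B)^T = 0 by rewrite -row_mul mulmx_ker row0.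
have {}r0 : (1%:M - a *: B) *m r^T = 0.
  by apply: trmx_inj; rewrite trmx_mul trmxK r0 trmx0.
move/eqP: r0; rewrite mulmxBl mul1mx -scalemxAl subr_eq0 => /eqP rE.
apply: trmx_inj; rewrite trmx0; apply/eqP; rewrite -dotm_eq0.
rewrite eq_le dotm_ge0 andbT {1}rE dotmZl.
by rewrite mulr_ge0_le0.
Qed.

(** In the stage lemmas u and w are the numerical and the exact value at time s,
and w' is the exact value at time t.  Measuring the error of a stage value y by
w' - y - (w - u), its excess over the error at the start of the step, makes
each stage act by Q_j alone. *)
Lemma implicit_stage_error (R : realType) (S : system R) (theta dt s t : R)
    (j : 'I_3) (x y u w w' : 'cV[R]_(sdim S)) :
  y = x + (theta * dt) *: (Fj j t y - Fj j s u) ->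
  Qj S theta dt j *m (w' - y - (w - u)) =
  w' - x - (w - u) - (theta * dt) *: (Fj j t w' - Fj j s w).
Proof.
rewrite /Qj /Zj scalerA mulmxBl mul1mx -scalemxAl !mulmxBr /Fj.
move: (Aj S j *m u) (Aj S j *m w) (Aj S j *m y) (Aj S j *m w').
move=> Au Aw Ay Aw' yE; rewrite {1}yE.
by apply/colP => i; rewrite !mxE; ring.
Qed.

Lemma explicit_stage_error (R : realType) (S : system R) (s t : R)
    (j : 'I_3) (z u w w' : 'cV[R]_(sdim S)) :
  Fj j t z - Fj j s u =
  (Fj j t w' - Fj j s w) - Aj S j *m (w' - z - (w - u)).
Proof.
rewrite !mulmxBr /Fj.
move: (Aj S j *m u) (Aj S j *m w) (Aj S j *m z) (Aj S j *m w').
by move=> Au Aw Ay Aw'; apply/colP => i; rewrite !mxE; ring.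
Qed.

Lemma explicit_stage_error_total (R : realType) (S : system R) (s t : R)
    (z u w w' : 'cV[R]_(sdim S)) :
  Ftot t z - Ftot s u =
  (Ftot t w' - Ftot s w) - Atot S *m (w' - z - (w - u)).
Proof.
have addB3 (a0 a1 a2 b0 b1 b2 : 'cV[R]_(sdim S)) :
    a0 + a1 + a2 - (b0 + b1 + b2) = (a0 - b0) + (a1 - b1) + (a2 - b2).
  by apply/colP => i; rewrite !mxE; ring.
rewrite /Ftot !addB3 !(explicit_stage_error s t _ z u w w').
by rewrite /Atot !mulmxDl addB3.
Qed.

Definition quadrature_defect (R : realType) (S : system R) (dt s t : R)
    (w w' : 'cV[R]_(sdim S)) : 'cV[R]_(sdim S) :=
  w' - w - (dt / 2) *: (Ftot t w' + Ftot s w).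

(** The vector xi whose image (R - I) xi is the part of the local error that is
only of second order.  The first coefficient is Z^-1 N and the last one comes
from Z^-1 Z_1, both with Z^-1 cancelled, so that no negative power of dt or
unbounded matrix remains. *)
Definition corrector (R : realType) (S : system R) (theta dt : R)
    (tau : 'cV[R]_(sdim S)) (delta : 'I_3 -> 'cV[R]_(sdim S)) :
    'cV[R]_(sdim S) :=
  let Ainv := invmx (Atot S) in
  (2^-1 *: 1%:M - theta *: (Ainv *m Aj S 1) - theta *: (Ainv *m Aj S 2)) *m
    (invmx (Pmat S theta dt + Nmat S theta dt) *m
      (tau + dt *: (2^-1 *: (delta 0 + delta 1 + delta 2)
                    - theta *: delta 1 - theta *: delta 2)))
  + (theta ^+ 2 * dt) *: (Ainv *m Aj S 1 *m delta 2).

(** Bounds P^-1, since both factors on the right are assumed to be O(1). *)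
Lemma invmx_via_sum (R : realType) (m : nat) (P N : 'M[R]_m) :
  P \in unitmx -> P + N \in unitmx ->
  invmx P = (1%:M + invmx P *m N) *m invmx (P + N).
Proof.
move=> Pu PNu; rewrite -[LHS](mulmxK PNu); congr (_ *m _).
by rewrite mulmxDr mulVmx.
Qed.

(** The first factor is G, where R - I = G Z.  Hence the contribution
P^-1 N P^-1 sigma of the predictor to the local error is (R - I) applied to
Z^-1 N (P + N)^-1 sigma. *)
Lemma second_stage_quotient (R : realType) (m : nat) (P N : 'M[R]_m) :
  P \in unitmx -> P + N \in unitmx ->
  (invmx P + invmx P *m N *m invmx P) *m N *m invmx (P + N) =
  invmx P *m N *m invmx P.
Proof.
move=> Pu PNu; rewrite -[RHS](mulmxK PNu); congr (_ *m _).
by rewrite mulmxDl mulmxDr mulmxKV.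
Qed.

(** Both sweeps through the implicit stages give the same right-hand side up to
the vector from which they start.  In the second sweep all increments of the
phi_j combine to the trapezoidal rule, whatever theta is; this is what makes
the scheme of order two. *)
Lemma MCS_step_error (R : realType) (S : system R) (theta dt s t : R)
    (u u' w w' : 'cV[R]_(sdim S)) :
  Qj S theta dt 1 \in unitmx -> Qj S theta dt 2 \in unitmx ->
  Atot S \in unitmx ->
  Pmat S theta dt + Nmat S theta dt \in unitmx ->
  MCS_step theta dt s t u u' ->
  let tau := quadrature_defect dt s t w w' in
  let xi := corrector theta dt tau (fun j => Fj j t w' - Fj j s w) in
  w' - u' = Rmat S theta dt *m (w - u) + invmx (Pmat S theta dt) *m tau
            + (Rmat S theta dt *m xi - xi).
Proof.
move=> Q1u Q2u Au PNu.
case=> Y0 [Y1 [Y2 [Yh0 [Yt0 [Yt1 [Yt2 []]]]]]].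
move=> Y0E [Y1E Y2E] [Yh0E Yt0E] [Yt1E Yt2E] -> tau xi.
have Pu : Pmat S theta dt \in unitmx by rewrite unitmx_mul Q1u.
pose e := w - u; pose d j := Fj j t w' - Fj j s w.
pose x := (theta ^+ 2 * dt) *: (Zj S dt 1 *m d 2).
pose sg :=
  tau + dt *: (2^-1 *: (d 0 + d 1 + d 2) - theta *: d 1 - theta *: d 2).
have dtot : Ftot t w' - Ftot s w = d 0 + d 1 + d 2.
  by rewrite /d /Ftot; apply/colP => i; rewrite !mxE; ring.
(* The defect of the stage with j = 2 is divided by Q_2 alone; over the common
   denominator P it becomes Q_1 delta_2 = delta_2 - theta Z_1 delta_2, and the
   second term is the origin of x. *)
have stages (X0 X1 X2 : 'cV[R]_(sdim S)) :
    X1 = X0 + (theta * dt) *: (Fj 1 t X1 - Fj 1 s u) ->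
    X2 = X1 + (theta * dt) *: (Fj 2 t X2 - Fj 2 s u) ->
    Pmat S theta dt *m (w' - X2 - e) =
    w' - X0 - e - (theta * dt) *: d 1 - (theta * dt) *: d 2 + x.
  move=> X1E X2E; rewrite /Pmat -mulmxA.
  rewrite (implicit_stage_error w w' X2E) mulmxBr.
  rewrite (implicit_stage_error w w' X1E) -/(d 1) -/(d 2) -/e.
  rewrite -scalemxAr /Qj mulmxBl mul1mx -scalemxAl /x.
  move: (Zj S dt 1 *m d 2) => Zd.
  by apply/colP => i; rewrite !mxE; ring.
have D0 : w' - Y0 - e = Ztot S dt *m e + tau + (dt / 2) *: (d 0 + d 1 + d 2).
  have := explicit_stage_error_total s s w u w w.
  rewrite Y0E /tau /quadrature_defect /Ztot -scalemxAl -dtot.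
  rewrite !subrr !sub0r mulmxN opprK => <-; rewrite /e.
  move: (Ftot s u) (Ftot s w) (Ftot t w') => a b c.
  by apply/colP => i; rewrite !mxE; field.
have D2 : Pmat S theta dt *m (w' - Y2 - e) = Ztot S dt *m e + sg + x.
  rewrite (stages Y0 Y1) // D0 /sg.
  move: (Ztot S dt *m e) => Ze.
  by apply/colP => i; rewrite !mxE; field.
have Dt : Pmat S theta dt *m (w' - Yt2 - e) =
    Ztot S dt *m e + tau + Nmat S theta dt *m (w' - Y2 - e) + x.
  rewrite (stages Yt0 Yt1) // Yt0E Yh0E.
  rewrite (explicit_stage_error s t 0 Y2 u w w').
  rewrite (explicit_stage_error_total s t Y2 u w w') -/e -/(d 0) dtot.
  rewrite /Nmat /Ztot /Zj (mulmxDl (theta *: _)) -!scalemxAl.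
  have -> : Y0 = w' - e - (w' - Y0 - e).
    by apply/colP => i; rewrite !mxE; ring.
  rewrite D0 /Ztot -scalemxAl.
  move: (Aj S 0 *m _) (Atot S *m (w' - Y2 - e)) (Atot S *m e) => a b c.
  by apply/colP => i; rewrite !mxE; field.
set P := Pmat S theta dt in Pu PNu stages D2 Dt *.
set N := Nmat S theta dt in PNu Dt *.
set Z := Ztot S dt in D0 D2 Dt *.
have PD (X y : 'cV[R]_(sdim S)) : P *m X = y -> X = invmx P *m y.
  by move=> <-; rewrite mulKmx.
pose G := invmx P + invmx P *m N *m invmx P.
have RE : Rmat S theta dt = 1%:M + G *m Z.
  by rewrite /Rmat -/P -/N -/Z -addrA /G mulmxDl.
have Zxi : Z *m xi = N *m (invmx (P + N) *m sg) + x.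
  rewrite /xi /corrector mulmxDr; congr (_ + _).
    rewrite -/P -/N -/sg mulmxA; congr (_ *m _).
    rewrite /Z /Ztot /N /Nmat /Ztot /Zj -scalemxAl !mulmxBr -!scalemxAr.
    rewrite mulmx1 !mulKVmx // /Atot.
    move: (Aj S 0) (Aj S 1) (Aj S 2) => A0 A1 A2.
    by apply/matrixP => i k; rewrite !mxE; field.
  rewrite -scalemxAr /Z /Ztot -scalemxAl -mulmxA mulKVmx //.
  by rewrite /x /Zj -scalemxAl.
have -> : w' - Yt2 = e + (w' - Yt2 - e) by rewrite [RHS]addrC subrK.
have -> : Rmat S theta dt *m xi - xi = G *m (Z *m xi).
  by rewrite RE mulmxDl mul1mx addrAC subrr add0r mulmxA.
rewrite Zxi RE (PD _ _ Dt) (PD _ _ D2) -/e.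
(* Matrices become opaque, so that distributivity expands only G. *)
clearbody P N Z e sg x tau; clear -Pu PNu.
have GN : G *m N *m invmx (P + N) = invmx P *m N *m invmx P.
  exact: second_stage_quotient.
rewrite !mulmxDr !mulmxA GN /G !mulmxDl mul1mx.
set a1 := invmx P *m Z *m e; set a2 := _ *m Z *m e.
set b1 := invmx P *m tau; set b2 := _ *m sg.
set c1 := invmx P *m x; set c2 := _ *m x.
clearbody a1 a2 b1 b2 c1 c2.
by apply/colP => i; rewrite !mxE; ring.
Qed.
(** * Accumulation of the errors *)

(** Summation by parts.  Terms (B - I) xi_k of size a enter the final error only
at the two ends, while in between only their increments count.  The induction
carries an arbitrary power of B, because boundedness of the powers does not
give B itself a norm at most 1. *)
Lemma error_accumulation (R : realType) (m : nat) (B : 'M[R]_m) (M a b : R)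
    (e xi eta : nat -> 'cV[R]_m) (N : nat) :
  0 <= M -> (forall j v, vnorm2 (B ^+ j *m v) <= M * vnorm2 v) ->
  e 0%N = 0 ->
  (forall n, (n < N)%N -> e n.+1 = B *m e n + eta n + (B *m xi n - xi n)) ->
  (forall n, (n < N)%N -> vnorm2 (xi n) <= a) ->
  (forall n, (n.+1 < N)%N -> vnorm2 (xi n.+1 - xi n) <= b) ->
  (forall n, (n < N)%N -> vnorm2 (eta n) <= b) ->
  forall n, (n < N)%N ->
    vnorm2 (e n.+1) <= (1 + M) * a + (2 * n%:R + 1) * M * b.
Proof.
move=> M0 BM e0 eS xia xib etab.
have BMle j v c : vnorm2 v <= c -> vnorm2 (B ^+ j *m v) <= M * c.
  by move=> vc; apply: le_trans (BM j v) _; rewrite ler_wpM2l.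
have expBS j v : B ^+ j *m (B *m v) = B ^+ j.+1 *m v.
  by rewrite exprSr -mulmxE mulmxA.
have key n : (n < N)%N -> forall j,
    vnorm2 (B ^+ j *m (e n.+1 + xi n)) <= M * a + (2 * n%:R + 1) * M * b.
  elim: n => [|n IHn] nN j.
    rewrite eS // e0 mulmx0 add0r addrA subrK mulmxDr expBS.
    apply: le_trans (ler_vnorm2D _ _) _.
    have := BMle j.+1 _ _ (xia 0%N nN); have := BMle j _ _ (etab 0%N nN).
    by clear; lra.
  rewrite eS // addrA subrK.
  have -> : B *m e n.+1 + eta n.+1 + B *m xi n.+1 =
      B *m (e n.+1 + xi n) + (B *m (xi n.+1 - xi n) + eta n.+1).
    rewrite mulmxDr mulmxBr.
    move: (B *m e _) (B *m xi n) (B *m xi n.+1) => x y z.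
    by apply/colP => i; rewrite !mxE; ring.
  rewrite (mulmxDr (B ^+ j)) (mulmxDr (B ^+ j)) !expBS.
  apply: le_trans (ler_vnorm2D _ _) _.
  have := ler_vnorm2D (B ^+ j.+1 *m (xi n.+1 - xi n)) (B ^+ j *m eta n.+1).
  have := BMle j.+1 _ _ (xib n nN); have := BMle j _ _ (etab n.+1 nN).
  have := IHn (ltnW nN) j.+1; rewrite -(natr1 n).
  by clear; lra.
move=> n nN; have := key n nN 0%N; rewrite (_ : B ^+ 0 = 1%:M) // mul1mx => h.
rewrite -(addrK (xi n) (e n.+1)); apply: le_trans (ler_vnorm2B _ _) _.
by have := xia n nN; move: h; clear; lra.
Qed.

Lemma correctorB (R : realType) (S : system R) (theta dt : R)
    (tau tau' : 'cV[R]_(sdim S)) (delta delta' : 'I_3 -> 'cV[R]_(sdim S)) :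
  corrector theta dt tau' delta' - corrector theta dt tau delta =
  corrector theta dt (tau' - tau) (fun j => delta' j - delta j).
Proof.
rewrite /corrector opprD addrACA; congr (_ + _).
  rewrite -!mulmxBr; congr (_ *m (_ *m _)).
  by apply/colP => i; rewrite !mxE; ring.
by rewrite -scalerBr -mulmxBr.
Qed.

(** The increments carry one power of dt less than tau because sigma and the last
term of the corrector multiply them by dt.  The lemma serves twice, for xi_n
and, through linearity, for xi_n - xi_(n-1). *)
Lemma corrector_bound (R : realType) (S : system R) (theta dt c1 c2 c3 r : R)
    (tau : 'cV[R]_(sdim S)) (delta : 'I_3 -> 'cV[R]_(sdim S)) :
  0 < theta -> 0 < dt -> 0 <= c1 -> 0 <= c2 -> 0 <= c3 ->
  mnorm2 (invmx (Atot S) *m Aj S 1) <= c1 ->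
  mnorm2 (invmx (Atot S) *m Aj S 2) <= c2 ->
  mnorm2 (invmx (Pmat S theta dt + Nmat S theta dt)) <= c3 ->
  vnorm2 tau <= r * dt -> (forall j, vnorm2 (delta j) <= r) ->
  vnorm2 (corrector theta dt tau delta) <=
  ((2^-1 + theta * c1 + theta * c2) * c3 * (5 / 2 + 2 * theta)
   + theta ^+ 2 * c1) * (r * dt).
Proof.
move=> th0 dt0 c10 c20 c30 A1c A2c PNc taur deltar.
have r0 : 0 <= r by apply: le_trans (deltar 0); exact: vnorm2_ge0.
have scaleb (a : R) v x : 0 <= a -> vnorm2 v <= x ->
    vnorm2 (a *: v : 'cV[R]_(sdim S)) <= a * x.
  by move=> a0 vx; rewrite vnorm2Z ger0_norm // ler_wpM2l.
have addb v w x y : vnorm2 v <= x -> vnorm2 w <= y ->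
    vnorm2 (v + w : 'cV[R]_(sdim S)) <= x + y.
  by move=> vx wy; apply: le_trans (ler_vnorm2D _ _) _; rewrite lerD.
have subb v w x y : vnorm2 v <= x -> vnorm2 w <= y ->
    vnorm2 (v - w : 'cV[R]_(sdim S)) <= x + y.
  by move=> vx wy; apply: addb; rewrite ?vnorm2N.
have th0' := ltW th0; have dt0' := ltW dt0.
have half0 : 0 <= 2^-1 :> R by rewrite invr_ge0.
rewrite /corrector; set y := invmx (Pmat S theta dt + _) *m _.
have yb : vnorm2 y <= c3 * (r * dt + dt * (2^-1 * (r + r + r)
    + theta * r + theta * r)).
  have t0 := scaleb _ _ _ half0
    (addb _ _ _ _ (addb _ _ _ _ (deltar 0) (deltar 1)) (deltar 2)).
  have t1 := scaleb _ _ _ th0' (deltar 1).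
  have t2 := scaleb _ _ _ th0' (deltar 2).
  apply: (vnorm2_mulmx_le PNc c30); apply: (addb _ _ _ _ taur).
  exact: (scaleb _ _ _ dt0' (subb _ _ _ _ (subb _ _ _ _ t0 t1) t2)).
rewrite !mulmxBl -!scalemxAl mul1mx.
have t1 : vnorm2 (2^-1 *: y) <= _ := scaleb _ _ _ half0 yb.
have t2 := scaleb _ _ _ th0' (vnorm2_mulmx_le A1c c10 yb).
have t3 := scaleb _ _ _ th0' (vnorm2_mulmx_le A2c c20 yb).
have t4 := scaleb _ _ _ (mulr_ge0 (sqr_ge0 theta) dt0')
  (vnorm2_mulmx_le A1c c10 (deltar 2)).
apply: le_trans (addb _ _ _ _ (subb _ _ _ _ (subb _ _ _ _ t1 t2) t3) t4) _.
by rewrite le_eqVlt; apply/orP; left; apply/eqP; field.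
Qed.

Lemma uniform_bound_family (R : realType) (H : set R) (T : R)
    (S : R -> system R) (J : finType)
    (f : J -> forall h : R, R -> 'cV[R]_(sdim (S h))) :
  (forall j, uniformly_bounded_on H T (f j)) ->
  exists2 K : R, 0 <= K & forall j h, H h -> forall t, t \in `[0, T] ->
    vnorm2 (f j h t) <= K.
Proof.
move=> /choice[K fK]; exists (\sum_j `|K j|); first exact: sumr_ge0.
move=> j h Hh t tT; apply: le_trans (fK j h Hh t tT) _.
apply: le_trans (ler_norm _) _.
by rewrite (bigD1 j) //= lerDl sumr_ge0.
Qed.

Theorem theorem2 (R : realType) (T theta : R) (T_gt0 : 0 < T)
  (theta_gt0 : 0 < theta)
  (H : set R) (H_mesh : mesh_widths H)
  (S : R -> system R)
  (U : forall h : R, R -> 'cV[R]_(sdim (S h)))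
  (U_exact : forall h, H h -> exact_solution T (U h))
  (V : forall h : R, R -> nat -> 'cV[R]_(sdim (S h)))
  (V_MCS : forall h, H h -> forall dt, 0 < dt ->
     MCS_approx theta dt T (V h dt))
  (* (i); dphi and ddphi are the first two derivatives of
     phi_j(t) = F_j(t, U(t)) on [0, T] *)
  (dphi ddphi : 'I_3 -> forall h : R, R -> 'cV[R]_(sdim (S h)))
  (phi_C2 : forall h, H h -> forall j : 'I_3,
     [/\ derivative_on T (fun t => Fj j t (U h t)) (dphi j h),
         derivative_on T (dphi j h) (ddphi j h)
       & {within `[0, T], continuous (ddphi j h)}])
  (ddphi_bounded : forall j : 'I_3, uniformly_bounded_on H T (ddphi j))
  (* a uniform bound on the phi_j' too: bounding only the phi_j'' does not
     suffice, see NOTES.md *)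
  (dphi_bounded : forall j : 'I_3, uniformly_bounded_on H T (dphi j))
  (* (ii) *)
  (A_dissipative : forall h, H h -> forall j : 'I_3, j != 0 ->
     forall v : 'cV[R]_(sdim (S h)), dotm (Aj (S h) j *m v) v <= 0)
  (* (iii) *)
  (stable : exists M : R, forall h, H h -> forall dt, 0 < dt ->
     forall n : nat, (1 <= n)%N -> mnorm2 (Rmat (S h) theta dt ^+ n) <= M)
  (* (iv) *)
  (A_unit : forall h, H h -> Atot (S h) \in unitmx)
  (PN_unit : forall h, H h -> forall dt, 0 < dt -> dt <= T ->
     Pmat (S h) theta dt + Nmat (S h) theta dt \in unitmx)
  (* (v) *)
  (A1_bounded : isO H T 0 (fun h dt n =>
     mnorm2 (invmx (Atot (S h)) *m Aj (S h) 1)))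
  (A2_bounded : isO H T 0 (fun h dt n =>
     mnorm2 (invmx (Atot (S h)) *m Aj (S h) 2)))
  (IPN_bounded : isO H T 0 (fun h dt n =>
     mnorm2 (1%:M + invmx (Pmat (S h) theta dt) *m Nmat (S h) theta dt)))
  (PN_inv_bounded : isO H T 0 (fun h dt n =>
     mnorm2 (invmx (Pmat (S h) theta dt + Nmat (S h) theta dt)))) :
  isO H T 2 (fun h dt n => vnorm2 (U h (n%:R * dt) - V h dt n)).
Proof.
have [K K0 dphiK] := uniform_bound_family dphi_bounded.
have [K2 K20 ddphiK] := uniform_bound_family ddphi_bounded.
case: stable => M stableM.
case: A1_bounded => c1 c10 A1c; case: A2_bounded => c2 c20 A2c.
case: IPN_bounded => c4 c40 IPNc; case: PN_inv_bounded => c3 c30 PNc.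
pose L := (2^-1 + theta * c1 + theta * c2) * c3 * (5 / 2 + 2 * theta)
          + theta ^+ 2 * c1.
have [th0' c10' c20' c30' [c40' T0']] :
    [/\ 0 <= theta, 0 <= c1, 0 <= c2, 0 <= c3 & 0 <= c4 /\ 0 <= T].
  by rewrite !ltW.
have L0 : 0 <= L by do ?[apply: addr_ge0|apply: mulr_ge0].
(* The zeroth power of R needs a constant that is at least 1. *)
pose M' := 1 + `|M|.
have M'1 : 1 <= M' by rewrite lerDl.
(* Rates for xi_n = O(dt^2) and for the O(dt^3) terms; 3 K2 bounds the second
   derivative of the sum of the phi_j. *)
pose Ca := L * (K + 3 * K2 * T).
pose Cb := L * (6 * K2) + c4 * c3 * (3 * K2).
have Ca0 : 0 <= Ca by do ?[apply: addr_ge0|apply: mulr_ge0].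
have Cb0 : 0 <= Cb by do ?[apply: addr_ge0|apply: mulr_ge0].
exists (1 + (1 + M') * Ca + 2 * M' * Cb * T).
  by rewrite -addrA ltr_pwDl //; do ?[apply: addr_ge0|apply: mulr_ge0].
move=> h Hh dt dt0 [//|N] _ NT.
have dt0' := ltW dt0.
have N0 : 0 <= N%:R :> R by [].
have dtT : dt <= T.
  move: NT; rewrite -natr1 mulrDl mul1r; apply: le_trans.
  by rewrite lerDr mulr_ge0.
(* The matrix bounds do not depend on the step number: take it to be 1. *)
have {}A1c := A1c h Hh dt dt0 1%N isT; have {}A2c := A2c h Hh dt dt0 1%N isT.
have {}IPNc := IPNc h Hh dt dt0 1%N isT; have {}PNc := PNc h Hh dt dt0 1%N isT.
rewrite mul1r expr0 !mulr1 in A1c A2c IPNc PNc.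
have {}A1c := A1c dtT; have {}A2c := A2c dtT.
have {}IPNc := IPNc dtT; have {}PNc := PNc dtT.
pose t k : R := k%:R * dt.
have tS k : t k.+1 = t k + dt by rewrite /t -natr1 mulrDl mul1r.
have t_ge0 k : 0 <= t k by rewrite mulr_ge0.
have t_leT k : (k <= N.+1)%N -> t k <= T.
  by move=> kN; apply: le_trans NT; rewrite ler_pM2r // ler_nat.
pose phi j x := Fj j x (U h x).
have phi1 j : derivative_on T (phi j) (dphi j h).
  by have [] := phi_C2 h Hh j.
have phi2 j : derivative_on T (dphi j h) (ddphi j h).
  by have [] := phi_C2 h Hh j.
pose tau k := quadrature_defect dt (t k) (t k.+1) (U h (t k)) (U h (t k.+1)).
pose delta k j := phi j (t k.+1) - phi j (t k).
pose xi k := corrector theta dt (tau k) (delta k).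
have Qu j : j != 0 -> Qj (S h) theta dt j \in unitmx.
  move=> j0; rewrite /Qj /Zj scalerA; apply: dissipative_shift_unit.
    by rewrite mulr_ge0 // ltW.
  exact: A_dissipative.
have Pu : Pmat (S h) theta dt \in unitmx by rewrite unitmx_mul !Qu.
have PNu := PN_unit h Hh dt dt0 dtT.
have tau_bound k : (k < N.+1)%N -> vnorm2 (tau k) <= 3 * K2 / 2 * dt ^+ 3.
  move=> kN; rewrite /tau tS.
  have d (F F' : 'I_3 -> R -> 'cV[R]_(sdim (S h))) :
      (forall j, derivative_on T (F j) (F' j)) ->
      derivative_on T (fun x => F 0 x + F 1 x + F 2 x)
        (fun x => F' 0 x + F' 1 x + F' 2 x).
    by move=> FF'; do 2?apply: derivative_onD => //.
  have d1 := d phi (fun j => dphi j h) phi1.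
  have d2 := d _ (fun j => ddphi j h) phi2.
  apply: (trapezoidal_bound (U_exact h Hh).1 d1 d2) => // [x xT|].
    rewrite (_ : 3 * K2 = K2 + K2 + K2); last by ring.
    apply: le_trans (ler_vnorm2D _ _) _; rewrite lerD ?ddphiK //.
    by apply: le_trans (ler_vnorm2D _ _) _; rewrite lerD ?ddphiK.
  by rewrite -tS t_leT.
have delta_bound k j : (k < N.+1)%N -> vnorm2 (delta k j) <= K * dt.
  move=> kN.
  have := lipschitz_bound (s := t k) (t := t k.+1) (phi1 j) (dphiK j h Hh).
  rewrite tS [t k + dt - _]addrC addKr ger0_norm // -tS; apply.
    by rewrite in_itv /= t_ge0 t_leT // ltnW.
  by rewrite in_itv /= t_ge0 t_leT.
have delta2_bound k j : (k.+1 < N.+1)%N ->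
    vnorm2 (delta k.+1 j - delta k j) <= 2 * K2 * dt ^+ 2.
  move=> kN; rewrite /delta !tS.
  apply: (second_difference_bound (phi1 j) (phi2 j) (ddphiK j h Hh)) => //.
  by rewrite -!tS t_leT.
(* One factor dt of the residual is traded for T, so that a single rate serves
   both arguments of the corrector. *)
have tauT : 3 * K2 / 2 * dt ^+ 3 <= (K + 3 * K2 * T) * dt * dt.
  have : 0 <= K * dt ^+ 2 by do ?[apply: mulr_ge0].
  have : 0 <= K2 * dt ^+ 2 * (T - dt).
    by do ?[apply: mulr_ge0]; rewrite ?subr_ge0.
  have : 0 <= K2 * dt ^+ 2 * T by do ?[apply: mulr_ge0].
  by clear; lra.
have K2dt k : 0 <= K2 * dt ^+ k by rewrite mulr_ge0 ?exprn_ge0.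
have xi_bound k : (k < N.+1)%N -> vnorm2 (xi k) <= Ca * dt ^+ 2.
  move=> kN; have -> : Ca * dt ^+ 2 = L * ((K + 3 * K2 * T) * dt * dt).
    by rewrite /Ca; ring.
  apply: corrector_bound => // [|j].
    exact: le_trans (tau_bound k kN) tauT.
  apply: le_trans (delta_bound k j kN) _.
  by rewrite ler_wpM2r // lerDl !mulr_ge0 // ltW.
have xi2_bound k : (k.+1 < N.+1)%N -> vnorm2 (xi k.+1 - xi k) <= Cb * dt ^+ 3.
  move=> kN; rewrite correctorB.
  apply: (@le_trans _ _ (L * (6 * K2 * dt ^+ 2 * dt))).
    apply: corrector_bound => // [|j].
      apply: le_trans (ler_vnorm2B _ _) _.
      have := tau_bound k.+1 kN; have := tau_bound k (ltnW kN).
      by have := K2dt 3%N; clear; lra.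
    apply: le_trans (delta2_bound k j kN) _.
    by have := K2dt 2%N; clear; lra.
  have := mulr_ge0 (mulr_ge0 c40' c30') (K2dt 3%N).
  by rewrite /Cb; clear; lra.
have eta_bound k : (k < N.+1)%N ->
    vnorm2 (invmx (Pmat (S h) theta dt) *m tau k) <= Cb * dt ^+ 3.
  move=> kN; rewrite (invmx_via_sum Pu PNu) -mulmxA.
  apply: le_trans (vnorm2_mulmx_le IPNc c40'
    (vnorm2_mulmx_le PNc c30' (tau_bound k kN))) _.
  have := mulr_ge0 (mulr_ge0 c40' c30') (K2dt 3%N).
  have := mulr_ge0 L0 (K2dt 3%N).
  by rewrite /Cb; clear; lra.
have stab j v : vnorm2 (Rmat (S h) theta dt ^+ j *m v) <= M' * vnorm2 v.
  case: j => [|j].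
    by rewrite (_ : _ ^+ 0 = 1%:M) // mul1mx ler_peMl ?vnorm2_ge0.
  apply: le_trans (ler_mnorm2 _ _) _; rewrite ler_wpM2r ?vnorm2_ge0 //.
  apply: le_trans (stableM h Hh dt dt0 j.+1 isT) _.
  by apply: le_trans (ler_norm _) _; rewrite lerDr.
have [V0 Vstep] := V_MCS h Hh dt dt0.
have := error_accumulation (e := fun k => U h (t k) - V h dt k) (xi := xi)
  (eta := fun k => invmx (Pmat (S h) theta dt) *m tau k) (N := N.+1)
  (le_trans ler01 M'1) stab _ _ xi_bound xi2_bound eta_bound (ltnSn N).
move=> /(_ _ _)/le_trans; apply.
- by rewrite /t mul0r (U_exact h Hh).2 V0 subrr.
- move=> k kN; apply: MCS_step_error => //.
  + exact: Qu.
  + exact: Qu.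
  + exact: A_unit.
  by apply: Vstep; exact: t_leT.
(* A number 2 N + 1 of increments of size dt^3, with (N + 1) dt <= T. *)
have MCb : 0 <= M' * Cb * dt ^+ 2 by rewrite !mulr_ge0 // (le_trans ler01).
have /(mulr_ge0 MCb) : 0 <= 2 * T - (2 * N%:R + 1) * dt.
  by move: NT; rewrite -natr1; move: dt0'; clear; lra.
have := sqr_ge0 dt.
by clear; lra.
Qed.
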